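(* Let $A\in\mathbb{R}^{n\times n}$, $B\in\mathbb{R}^{n\times m}$, $\sigma\in\mathbb{R}$, $\tau>0$, and let $L\in\mathbb{R}^{n\times n}$ and $R\in\mathbb{R}^{m\times m}$ be positive definite matrices. Let $f:\mathbb{S}_n^+\to\mathbb{S}_n^+$ be the map, determined by $(A,B,\sigma,\tau,L,R)$, defined in the context. If $f$ has a fixed point $W\in\mathbb{S}_n^+$ (i.e., $f(W)=W$), then this fixed point is unique. Moreover, for any $P\in\mathbb{S}_n^+$, $\lim_{N\to\infty} f^N(P)=W$, where $f^N$ denotes the $N$-fold composition of $f$ with itself.
   Context: $\mathbb{S}_n^+$ denotes the cone of real symmetric positive semidefinite $n\times n$ matrices; ''positive definite'' means symmetric positive definite. For $W\in\mathbb{S}_n^+$, set $$Q(s):=\sigma^2 B^\top e^{A^\top s}We^{As}B+R,\qquad M:=\int_0^\tau e^{As}BQ^{-1}(s)B^\top e^{A^\top s}\,ds$$ (both depend on $W$), and define $$f(W):=e^{A^\top\tau}W^{1/2}\left(I+W^{1/2}MW^{1/2}\right)^{-1}W^{1/2}e^{A\tau}+\tau L,$$ where $W^{1/2}$ is the positive semidefinite square root of $W$. *)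

(* Defs.v *)
From HB Require Import structures.
From mathcomp Require Import all_boot all_order all_algebra.
From mathcomp Require Import all_classical all_reals all_analysis.
Import Order.TTheory GRing.Theory Num.Theory.
Import numFieldNormedType.Exports.

Set Implicit Arguments.
Unset Strict Implicit.
Unset Printing Implicit Defensive.

Local Open Scope classical_set_scope.
Local Open Scope ring_scope.

Definition psdmx (K : realType) (n : nat) (W : 'M[K]_n) : Prop :=
  W \is symmetricmx /\
  forall x : 'cV[K]_n, 0 <= (x^T *m W *m x) ord0 ord0.

Definition pdmx (K : realType) (n : nat) (W : 'M[K]_n) : Prop :=
  W \is symmetricmx /\
  forall x : 'cV[K]_n, x != 0 -> 0 < (x^T *m W *m x) ord0 ord0.

(* The series is taken in the normed space of matrices (max norm), where it
   converges for every A. *)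
Definition expmx (K : realType) (n : nat) (A : 'M[K]_n) : 'M[K]_n :=
  limn (series (fun k : nat => (k`!%:R)^-1 *: A ^+ k)).

(* A positive semidefinite matrix has exactly one positive semidefinite square
   root, so the choice made by xget is immaterial there; when W is not positive
   semidefinite the value is the default 0. *)
Definition psd_sqrtmx (K : realType) (n : nat) (W : 'M[K]_n) : 'M[K]_n :=
  xget 0 [set S : 'M[K]_n | psdmx S /\ S *m S = W].

Definition Qmx (K : realType) (n m : nat) (A : 'M[K]_n) (B : 'M[K]_(n, m))
    (sigma : K) (R : 'M[K]_m) (W : 'M[K]_n) (s : K) : 'M[K]_m :=
  sigma ^+ 2 *: (B^T *m expmx (s *: A^T) *m W *m expmx (s *: A) *m B) + R.

(* The matrix-valued integral is taken entrywise. *)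
Definition Mmx (K : realType) (n m : nat) (A : 'M[K]_n) (B : 'M[K]_(n, m))
    (sigma tau : K) (R : 'M[K]_m) (W : 'M[K]_n) : 'M[K]_n :=
  \matrix_(i < n, j < n) \int[lebesgue_measure]_(s in `[0, tau])
    (expmx (s *: A) *m B *m invmx (Qmx A B sigma R W s)
       *m B^T *m expmx (s *: A^T)) i j.

(* The map is only meaningful, and only used, on positive semidefinite W: there
   both inverted matrices are positive definite, so invmx is a genuine
   inverse, and the value is again positive semidefinite. *)
Definition fmx (K : realType) (n m : nat) (A : 'M[K]_n) (B : 'M[K]_(n, m))
    (sigma tau : K) (L : 'M[K]_n) (R : 'M[K]_m) (W : 'M[K]_n) : 'M[K]_n :=
  let S := psd_sqrtmx W in
  expmx (tau *: A^T) *m S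
    *m invmx (1%:M + S *m Mmx A B sigma tau R W *m S)
    *m S *m expmx (tau *: A)
  + tau *: L.

(* Main.v *)
Require Import Defs.
From HB Require Import structures.
From mathcomp Require Import all_boot all_order all_algebra.
From mathcomp Require Import perm sesquilinear spectral ring lra.
From mathcomp.real_closed Require Import complex.
From mathcomp Require Import all_classical all_reals all_analysis.
Import Order.TTheory GRing.Theory Num.Theory.
Import numFieldNormedType.Exports.
Local Open Scope classical_set_scope.
Local Open Scope ring_scope.

Set Implicit Arguments.
Unset Strict Implicit.
Unset Printing Implicit Defensive.

(** Why the fixed point attracts every orbit.  Write X <= Y for the Loewner
    order.  For positive definite X the square roots in f cancel and
    [f X = E^T (X^-1 + M X)^-1 E + tau L] with [E = exp (tau A)] ([gmx_pdE]).
    Two properties of f follow from this formula.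

    - f is monotone ([fmx_mono]): Q increases with X and inversion reverses the
      order of positive definite matrices ([loewner_inv]), so M decreases, and
      so does [X^-1 + M X]; one more inversion restores the order.
    - f is strictly subhomogeneous ([fmx_subhom]): for b >= 1,
      [f (b X) <= b f X - (b - 1) tau L].  Since R <= b R, Q at b X is at most
      b times Q at X, hence [M (b X) >= b^-1 M X], and inversion yields the
      factor b for the first summand of f; the constant summand tau L does
      not scale, which produces the gain.

    A fixed point W satisfies W >= tau L > 0, so (1 - rho) W <= tau L for some
    rho < 1 ([contraction_rate]).  If X <= (1 + t) W then
    [f X <= f ((1 + t) W) <= (1 + t) W - t tau L <= (1 + rho t) W], and dually
    X >= (1 - u) W implies f X >= (1 - rho u) W.  For any positive
    semidefinite P, the matrix f P >= tau L is positive definite, hence lies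
    between two such multiples of W, and its orbit is squeezed onto W at the
    geometric rate rho ([iter_fmx_bounds], [loewner_squeeze]).  Uniqueness
    follows, because the orbit of another fixed point is constant.

    The order is handled through quadratic forms only.  Two foundations are
    needed: a positive semidefinite matrix has a positive semidefinite square
    root ([psdmx_sqrt]), and the quadratic form of M is the integral of the
    quadratic forms of its integrand ([qform_Rintegral]), which is
    integrable because the matrix exponential is continuous. *)

(** * Quadratic forms and the Loewner order *)

Definition qform (K : realType) (n : nat) (X : 'M[K]_n) (x : 'cV[K]_n) : K :=
  (x^T *m X *m x) ord0 ord0.

Lemma symmxP (K : realType) (n : nat) (X : 'M[K]_n) :
  reflect (X^T = X) (X \is symmetricmx).
Proof.
apply: (iffP (is_hermitianmxP _ _ _)); rewrite expr0 scale1r map_mx_id//.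
Qed.

Lemma qformE (K : realType) (n : nat) (X : 'M[K]_n) x :
  qform X x = \sum_i \sum_j x i 0 * X i j * x j 0.
Proof.
rewrite /qform mxE exchange_big; apply: eq_bigr => j _.
rewrite mxE mulr_suml; apply: eq_bigr => i _.
by rewrite mxE !ord1.
Qed.

Lemma qform_gram (K : realType) (n : nat) (T : 'M[K]_n) x :
   0 <= qform (T^T *m T) x.
Proof.
rewrite /qform mulmxA -mulmxA -trmx_mul mxE sumr_ge0// => i _.
by rewrite mxE -expr2 sqr_ge0.
Qed.

Definition loewner (K : realType) (n : nat) (X Y : 'M[K]_n) : Prop :=
  forall x, qform X x <= qform Y x.

Lemma qformD (K : realType) (n : nat) (X Y : 'M[K]_n) x :
  qform (X + Y) x = qform X x + qform Y x.
Proof. by rewrite /qform mulmxDr mulmxDl mxE. Qed.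

Lemma qformZ (K : realType) (n : nat) a (X : 'M[K]_n) x :
  qform (a *: X) x = a * qform X x.
Proof. by rewrite /qform -scalemxAr -scalemxAl mxE. Qed.

Lemma qform0 (K : realType) (n : nat) (X : 'M[K]_n) : qform X 0 = 0.
Proof. by rewrite /qform mulmx0 mxE. Qed.

Lemma qform_congr (K : realType) (n p : nat) (C : 'M[K]_(n, p))
    (X : 'M[K]_n) x :
  qform (C^T *m X *m C) x = qform X (C *m x).
Proof. by rewrite /qform trmx_mul !mulmxA. Qed.

Lemma qform_scalar (K : realType) (n : nat) (c : K) (x : 'cV[K]_n) :
  qform c%:M x = c * \sum_i x i 0 ^+ 2.
Proof.
rewrite /qform mul_mx_scalar -scalemxAl !mxE; congr (_ * _).
by apply: eq_bigr => i _; rewrite mxE expr2.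
Qed.

Lemma qform_addv (K : realType) (n : nat) (X : 'M[K]_n) x y :
  X^T = X ->
  qform X (x + y) = qform X x + 2 * (y^T *m X *m x) ord0 ord0 + qform X y.
Proof.
move=> Xsym.
  have xyT : (x + y)^T = x^T + y^T by apply/matrixP => i j; rewrite !mxE.
  have addE (U V : 'M[K]_1) : (U + V) ord0 ord0 = U ord0 ord0 + V ord0 ord0.
    by rewrite mxE.
  rewrite /qform xyT !mulmxDl !mulmxDr !addE.
  suff -> : (x^T *m X *m y) ord0 ord0 = (y^T *m X *m x) ord0 ord0 by ring.
  transitivity ((x^T *m X *m y)^T ord0 ord0); first by rewrite [RHS]mxE.
  by rewrite !trmx_mul trmxK Xsym mulmxA.
Qed.

Lemma pdmx_psd (K : realType) (n : nat) (X : 'M[K]_n) : pdmx X -> psdmx X.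
Proof.
move=> [Xsym Xpos]; split=> // x; have [->|/Xpos/ltW//] := eqVneq x 0.
by rewrite -/(qform X 0) qform0.
Qed.

Lemma qform_ge0 (K : realType) (n : nat) (X : 'M[K]_n) x :
  psdmx X -> 0 <= qform X x.
Proof. by move=> [_ Xge0]; exact: Xge0. Qed.

Lemma pdmx_add (K : realType) (n : nat) (X Y : 'M[K]_n) :
  psdmx X -> pdmx Y -> pdmx (X + Y).
Proof.
move=> [/symmxP Xs X0] [/symmxP Ys Y0]; split.
  by apply/symmxP; rewrite linearD /= Xs Ys.
by move=> x x0; rewrite -/(qform _ x) qformD ltr_wpDl ?X0 ?Y0.
Qed.

Lemma psdmx_congr (K : realType) (n p : nat) (C : 'M[K]_(n, p)) (X : 'M[K]_n) :
  psdmx X -> psdmx (C^T *m X *m C).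
Proof.
move=> [/symmxP Xs X0]; split; last first.
  by move=> x; rewrite -/(qform _ x) qform_congr X0.
by apply/symmxP; rewrite !trmx_mul trmxK Xs mulmxA.
Qed.

Lemma psdmxZ (K : realType) (n : nat) a (X : 'M[K]_n) :
  0 <= a -> psdmx X -> psdmx (a *: X).
Proof.
move=> a0 [/symmxP Xs X0]; split; first by apply/symmxP; rewrite linearZ /= Xs.
by move=> x; rewrite -/(qform _ x) qformZ mulr_ge0// X0.
Qed.

Lemma pdmxZ (K : realType) (n : nat) a (X : 'M[K]_n) :
  0 < a -> pdmx X -> pdmx (a *: X).
Proof.
move=> a0 [/symmxP Xs X0]; split; first by apply/symmxP; rewrite linearZ /= Xs.
by move=> x xn0; rewrite -/(qform _ x) qformZ mulr_gt0// X0.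
Qed.

Lemma pdmx_scalar (K : realType) (n : nat) (c : K) :
  0 < c -> pdmx (c%:M : 'M[K]_n).
Proof.
move=> c0; split; first by apply/symmxP; rewrite tr_scalar_mx.
move=> x xn0; rewrite -/(qform _ x) qform_scalar mulr_gt0//.
rewrite lt_neqAle sumr_ge0 ?andbT => [|i _]; last exact: sqr_ge0.
apply: contraNneq xn0 => /esym/eqP; rewrite psumr_eq0 => [|i _]; last first.
  exact: sqr_ge0.
move=> /allP x0; apply/eqP/colP => i; rewrite mxE.
by have := x0 i (mem_index_enum _); rewrite sqrf_eq0 => /eqP.
Qed.

Lemma pdmx_unit (K : realType) (n : nat) (X : 'M[K]_n) : pdmx X -> X \in unitmx.
Proof.
move=> [Xsym Xpos]; rewrite -row_free_unit -kermx_eq0.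
apply/negPn/negP => /rowV0Pn[v /sub_kermxP vX v0].
suff /Xpos : v^T != 0 by rewrite trmxK vX mul0mx mxE ltxx.
by rewrite -(inj_eq (@trmx_inj _ _ _)) trmxK trmx0.
Qed.

Lemma qform_inv (K : realType) (n : nat) (X : 'M[K]_n) x :
  pdmx X -> qform (invmx X) x = qform X (invmx X *m x).
Proof.
move=> Xpd; have Xu := pdmx_unit Xpd; case: Xpd => /symmxP Xs _.
by rewrite /qform trmx_mul trmx_inv Xs mulmxKV// mulmxA.
Qed.

Lemma pdmx_inv (K : realType) (n : nat) (X : 'M[K]_n) :
  pdmx X -> pdmx (invmx X).
Proof.
move=> Xpd; have Xu := pdmx_unit Xpd; have [/symmxP Xs X0] := Xpd.
split; first by apply/symmxP; rewrite trmx_inv Xs.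
move=> x x0; rewrite -/(qform _ x) qform_inv//; apply: X0.
by apply: contraNneq x0 => /(congr1 (mulmx X)); rewrite mulKVmx// mulmx0 => ->.
Qed.

(** Inversion reverses the order because [x^T X^-1 x] is the maximum over u of
    [2 u^T x - u^T X u], a quantity that decreases when X grows.  The maximum
    for Y is reached at u = Y^-1 x, and evaluating the X-expression at that u
    gives the inequality. *)
Lemma loewner_inv (K : realType) (n : nat) (X Y : 'M[K]_n) :
  pdmx X -> pdmx Y -> loewner X Y -> loewner (invmx Y) (invmx X).
Proof.
move=> Xpd Ypd XY x.
have Xu := pdmx_unit Xpd; have Yu := pdmx_unit Ypd.
have [/symmxP Xs _] := Xpd; have [/symmxP Ys _] := Ypd.
(* The maximizer of the variational formula for Y. *)
set u := invmx Y *m x.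
have uN : (- u)^T = - u^T by apply/matrixP => i j; rewrite !mxE.
(* Completing the square around the maximizer for X. *)
have := qform_ge0 (invmx X *m x - u) (pdmx_psd Xpd).
rewrite qform_addv// -qform_inv//.
have -> : ((- u)^T *m X *m (invmx X *m x)) ord0 ord0 = - qform (invmx Y) x.
  rewrite mulmxA mulmxK// uN mulNmx mxE; congr (- _).
  by rewrite /u trmx_mul trmx_inv Ys.
have -> : qform X (- u) = qform X u.
  by rewrite /qform uN !mulNmx mulmxN opprK.
have := XY u; rewrite -(qform_inv _ Ypd); lra.
Qed.

Lemma loewner_bounded (K : realType) (n : nat) (X : 'M[K]_n) :
  exists2 c : K, 0 < c & loewner X c%:M.
Proof.
exists (1 + \sum_i \sum_j `|X i j|).
  by rewrite ltr_wpDr// sumr_ge0// => i _; rewrite sumr_ge0.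
move=> x; rewrite qform_scalar mulrDl mul1r.
set N := \sum_i x i 0 ^+ 2.
have sqN i : `|x i 0| ^+ 2 <= N.
  rewrite real_normK ?num_real// /N (bigD1 i)//= lerDl sumr_ge0// => j _.
  exact: sqr_ge0.
rewrite -[leLHS]add0r lerD//.
  by rewrite sumr_ge0// => i _; exact: sqr_ge0.
rewrite qformE mulr_suml ler_sum// => i _; rewrite mulr_suml ler_sum// => j _.
apply: le_trans (ler_norm _) _; rewrite !normrM -mulrA mulrCA ler_wpM2l//.
have := sqN i; have := sqN j.
have := sqr_ge0 (`|x i 0| - `|x j 0|); rewrite sqrrB; lra.
Qed.

(** Y is below a multiple of I, so X has to be above one: bounding X^-1 above
    by c I and inverting gives X >= c^-1 I. *)
Lemma loewner_dominated (K : realType) (n : nat) (X Y : 'M[K]_n) :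
  pdmx X -> exists2 c : K, 0 < c & loewner Y (c *: X).
Proof.
move=> Xpd; have [b b0 Yb] := loewner_bounded Y.
have [c c0 Xc] := loewner_bounded (invmx X).
exists (b * c); first exact: mulr_gt0.
move=> x; apply: le_trans (Yb x) _.
rewrite qformZ qform_scalar -mulrA ler_pM2l//.
have /(_ x) := loewner_inv (pdmx_inv Xpd) (pdmx_scalar n c0) Xc.
by rewrite invmxK invmx_scalar qform_scalar mulrC ler_pdivrMr// mulrC.
Qed.

(** * Square roots of positive semidefinite matrices *)

Lemma interpolation (F : fieldType) (s : seq F) (y : F -> F) :
  exists p : {poly F}, forall x, x \in s -> p.[x] = y x.
Proof.
elim: s => [|a s [p ps]]; first by exists 0.
have [as_|as_] := boolP (a \in s).
  by exists p => x; rewrite inE => /predU1P[->|]; exact: ps.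
pose q := \prod_(b <- s) ('X - b%:P).
have qa : q.[a] != 0 by rewrite -[_ == 0]/(root q a) root_prod_XsubC.
exists (p + ((y a - p.[a]) / q.[a]) *: q) => x; rewrite inE !hornerE.
move=> /predU1P[->|xs]; first by rewrite divfK// subrKC.
have /rootP -> : root q x by rewrite root_prod_XsubC.
by rewrite mulr0 addr0; exact: ps.
Qed.

(** The spectral theorem over the complex numbers, together with the fact that
    a hermitian matrix has real eigenvalues. *)
Lemma symmx_diagonalizable (K : realType) (n : nat) (X : 'M[K]_n.+1) :
  X^T = X -> exists (P : 'M[K[i]]_n.+1) (d : 'rV[K]_n.+1), P \in unitmx /\
    map_mx (real_complex K) X =
      invmx P *m diag_mx (map_mx (real_complex K) d) *m P.
Proof.
move=> Xsym; set XC := map_mx _ X.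
have XCherm : XC \is hermsymmx.
  apply/is_hermitianmxP; rewrite expr0 scale1r.
  apply/matrixP => i j; rewrite !mxE -{1}Xsym mxE.
  by apply/esym/CrealP; rewrite complex_real.
have XCspec := orthomx_spectralP (hermitian_normalmx XCherm).
have /mxOverP dreal := hermitian_spectral_diag_real XCherm.
exists (spectralmx XC), (map_mx (@complex.Re K) (spectral_diag XC)).
split; first exact: spectral_unit.
have -> : map_mx (real_complex K) (map_mx (@complex.Re K) (spectral_diag XC)) =
          spectral_diag XC by apply/rowP => i; rewrite !mxE RRe_real.
exact: XCspec.
Qed.

(** If p interpolates the fourth roots of the eigenvalues of X, then
    T = p(X) satisfies T^4 = X, as one sees after diagonalization over the
    complex numbers.  Taking a real polynomial in X keeps T real and symmetric
    although the diagonalizing matrix is complex, and taking fourth roots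
    makes the square root T T = T^T T visibly positive semidefinite. *)
Lemma psdmx_sqrt (K : realType) (n : nat) (X : 'M[K]_n) :
  psdmx X -> exists S, psdmx S /\ S *m S = X.
Proof.
case: n X => [|n] X.
  by move=> Xpsd; exists X; split=> //; apply/matrixP => -[].
move=> [/symmxP Xsym Xge0].
have [P [d [Pu XE]]] := symmx_diagonalizable Xsym.
have d_ge0 i : 0 <= d 0 i.
  have : eigenvalue (map_mx (real_complex K) X) (real_complex K (d 0 i)).
    apply/eigenvalueP; exists (row i P).
      rewrite XE !mulmxA -row_mul mulmxV// row1.
      rewrite -rowE row_diag_mx -scalemxAl -rowE mxE//.
    apply: contraTneq Pu => Pi0; apply/negP => Pu.
    have := congr1 (mulmx^~ (invmx P)) Pi0.
    rewrite mul0mx rowE mulmxK// => /rowP/(_ i); rewrite !mxE !eqxx.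
    by move=> /eqP; rewrite oner_eq0.
  (* A real eigenvalue has a real eigenvector, which can be tested against X. *)
  rewrite eigenvalue_root_char -map_char_poly fmorph_root.
  rewrite -eigenvalue_root_char => /eigenvalueP[v vX v0].
  have := Xge0 v^T; rewrite trmxK vX -scalemxAl mxE.
  have vv : 0 < (v *m v^T) ord0 ord0.
    rewrite lt_neqAle mxE sumr_ge0 ?andbT; last first.
      by move=> j _; rewrite mxE -expr2 sqr_ge0.
    apply: contraNneq v0 => /esym/eqP; rewrite psumr_eq0; last first.
      by move=> j _; rewrite mxE -expr2 sqr_ge0.
    move=> /allP v0; apply/eqP/rowP => j; have := v0 j (mem_index_enum _).
    by rewrite !mxE mulf_eq0 orbb => /eqP.
  by rewrite pmulr_lge0.
have [p pE] := interpolation [seq d 0 i | i <- enum 'I_n.+1]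
  (fun x => Num.sqrt (Num.sqrt x)).
have pd i : (p ^+ 4).[d 0 i] = d 0 i.
  rewrite horner_exp pE; last by rewrite map_f// mem_enum.
  by rewrite (exprM _ 2 2) !sqr_sqrtr// sqrtr_ge0.
have p4X : horner_mx X (p ^+ 4) = X.
  apply: (@map_mx_inj _ _ (real_complex K)).
  rewrite map_horner_mx {1}XE horner_mx_uconjC// horner_mx_diag.
  have -> : map_mx (horner (map_poly (real_complex K) (p ^+ 4)))
                   (map_mx (real_complex K) d) = map_mx (real_complex K) d.
    by apply/rowP => i; rewrite !mxE horner_map pd.
  exact/esym.
have T_sym : (horner_mx X p)^T = horner_mx X p.
  rewrite -[p]coefK poly_def rmorph_sum/= raddf_sum/=; apply: eq_bigr => i _.
  rewrite linearZ /= rmorphXn/= horner_mx_X linearZ/=; congr (_ *: _).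
  elim: (nat_of_ord i) => [|k IH]; first by rewrite trmx1.
  by rewrite {1}exprSr trmx_mul IH Xsym exprS.
set T := horner_mx X p in T_sym.
exists (T *m T); split; last first.
  by rewrite -p4X rmorphXn /= -/T !mulmxE -!expr2 -exprM.
split; first by apply/symmxP; rewrite trmx_mul T_sym.
by move=> x; rewrite -{1}T_sym; exact: qform_gram.
Qed.

Lemma psd_sqrtmx_psd (K : realType) (n : nat) (X : 'M[K]_n) :
  psdmx (psd_sqrtmx X).
Proof.
rewrite /psd_sqrtmx; case: xgetP => [S _ [] //|_].
split; first by apply/symmxP; rewrite trmx0.
by move=> x; rewrite mulmx0 mul0mx mxE.
Qed.

Lemma psd_sqrtmxK (K : realType) (n : nat) (X : 'M[K]_n) :
  psdmx X -> psd_sqrtmx X *m psd_sqrtmx X = X.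
Proof. by move=> /psdmx_sqrt ex; have [] := xgetPex 0 ex. Qed.

(** * Entrywise convergence and the matrix exponential *)

Lemma cvg_mx (T : Type) (F : set_system T) (FF : Filter F) (K : realType)
    (p q : nat) (f : T -> 'M[K]_(p, q)) (l : 'M[K]_(p, q)) :
  (forall i j, f t i j @[t --> F] --> l i j) -> f @ F --> l.
Proof.
move=> fl A [P lP PA].
have : \forall t \near F, forall i j, P i j (f t i j).
  by apply: filter_forall => i; apply: filter_forall => j; exact: fl (lP i j).
by apply: filterS => t Pt; exact: PA.
Qed.

(** Coefficients dominated by those of an exponential.  This class of entire
    power series is closed under termwise differentiation, which is what
    the criterion for differentiating a power series requires. *)
Definition exp_bounded (K : realType) (c : nat -> K) : Prop :=
  exists C a : K, forall k, `|c k| <= C * a ^+ k / k`!%:R.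

Lemma exp_bounded_diffs (K : realType) (c : nat -> K) :
  exp_bounded c -> exp_bounded (pseries_diffs c).
Proof.
move=> [C [a ca]]; exists (C * a), a => k.
rewrite /pseries_diffs normrM normr_nat.
rewrite -ler_pdivlMl ?ltr0n//; apply: le_trans (ca k.+1) _.
rewrite factS natrM invfM exprS le_eqVlt; apply/orP; left; apply/eqP; ring.
Qed.

Lemma exp_bounded_cvg (K : realType) (c : nat -> K) (x : K) :
  exp_bounded c -> cvgn (pseries c x).
Proof.
move=> [C [a ca]]; apply: normed_cvg.
have C_ge0 : 0 <= C.
  apply: le_trans (normr_ge0 (c 0%N)) _.
  by have := ca 0%N; rewrite fact0 divr1 mulr1.
have ub k : `|c k * x ^+ k| <= C * exp_coeff (`|a| * `|x|) k.
  rewrite normrM normrX /exp_coeff /= exprMn.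
  have -> : C * (`|a| ^+ k * `|x| ^+ k / k`!%:R) =
            C * `|a| ^+ k / k`!%:R * `|x| ^+ k by ring.
  rewrite ler_wpM2r ?exprn_ge0//; apply: le_trans (ca k) _.
  rewrite ler_wpM2r ?invr_ge0 ?ler0n// ler_wpM2l//.
  by rewrite -normrX ler_norm.
apply: (series_le_cvg (v_ := C *: exp_coeff (`|a| * `|x|))) => //.
- by move=> k; exact: normr_ge0.
- by move=> k; apply: (le_trans _ (ub k)); exact: normr_ge0.
- apply: (@is_cvg_seriesZ _ (exp_coeff (`|a| * `|x|)) C).
  exact: is_cvg_series_exp_coeff.
Qed.

Lemma exp_bounded_continuous (K : realType) (c : nat -> K) :
  exp_bounded c -> continuous (fun x : K => limn (pseries c x)).
Proof.
move=> ec x; apply: differentiable_continuous; apply/derivable1_diffP.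
apply: (@ex_derive _ _ _ _ _ _ (limn (pseries (pseries_diffs c) x))).
(* Any radius larger than the norm of x would do. *)
apply: (@pseries_snd_diffs _ _ (`|x| + 1)).
- exact: exp_bounded_cvg.
- by apply: exp_bounded_cvg; exact: exp_bounded_diffs.
- by apply: exp_bounded_cvg; do 2 apply: exp_bounded_diffs.
- by rewrite [ltRHS]ger0_norm ?addr_ge0// ltrDl.
Qed.

Definition expmx_coef (K : realType) (n : nat) (A : 'M[K]_n) i j k : K :=
  (k`!%:R)^-1 * (A ^+ k) i j.

(** With a the sum of the absolute values of the entries of A, induction
    on k bounds those of A^k by a^k. *)
Lemma expmx_coef_bounded (K : realType) (n : nat) (A : 'M[K]_n) i j :
  exp_bounded (expmx_coef A i j).
Proof.
pose a := \sum_k \sum_l `|A k l|; exists 1, a => k.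
rewrite mul1r /expmx_coef normrM ger0_norm ?invr_ge0// mulrC.
rewrite ler_wpM2r ?invr_ge0//.
have a_ge0 : 0 <= a by rewrite sumr_ge0// => ? _; rewrite sumr_ge0.
elim: k i j => [|k IH] i j.
  by rewrite !expr0 mxE; case: eqP; rewrite ?normr1 ?normr0.
rewrite !exprSr -mulmxE mxE; apply: le_trans (ler_norm_sum _ _ _) _.
apply: (@le_trans _ _ (\sum_l a ^+ k * `|A l j|)).
  by apply: ler_sum => l _; rewrite normrM ler_wpM2r.
rewrite -mulr_sumr ler_wpM2l ?exprn_ge0//.
by apply: ler_sum => l _; rewrite (bigD1 j)//= lerDl sumr_ge0.
Qed.

Lemma exprZmx (K : realType) (n : nat) (A : 'M[K]_n) (s : K) k :
  (s *: A) ^+ k = s ^+ k *: A ^+ k.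
Proof.
elim: k => [|k IH]; first by rewrite !expr0 scale1r.
by rewrite !exprS IH -!mulmxE -scalemxAl -scalemxAr scalerA.
Qed.

(** Entrywise, the exponential is an entire power series in s; continuity and
    compatibility with transposition are read off from this form. *)
Lemma expmxE (K : realType) (n : nat) (A : 'M[K]_n) (s : K) i j :
  expmx (s *: A) i j = limn (pseries (expmx_coef A i j) s).
Proof.
rewrite /expmx; set u := series _.
have : u @ \oo --> \matrix_(i, j) limn (pseries (expmx_coef A i j) s).
  apply: cvg_mx => k l; rewrite mxE.
  suff -> : (fun t => u t k l) = pseries (expmx_coef A k l) s.
    exact: exp_bounded_cvg (expmx_coef_bounded A k l).
  apply/funext => N; rewrite /u /pseries /series /= summxE.
  apply: eq_bigr => r _; rewrite !mxE exprZmx mxE /expmx_coef; ring.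
by move=> /cvg_lim -> //; rewrite mxE.
Qed.

Lemma expmx_tr (K : realType) (n : nat) (A : 'M[K]_n) (s : K) :
  expmx (s *: A^T) = (expmx (s *: A))^T.
Proof.
apply/matrixP => i j; rewrite mxE !expmxE; congr (limn (pseries _ s)).
apply/funext => k; rewrite /expmx_coef; congr (_ * _).
suff -> : A^T ^+ k = (A ^+ k)^T by rewrite mxE.
elim: k => [|k IH]; first by rewrite trmx1.
by rewrite exprS IH exprSr -!mulmxE trmx_mul.
Qed.

Definition mx_continuous (K : realType) (p q : nat) 
    (F : K -> 'M[K]_(p, q)) : Prop :=
  forall i j, continuous (fun s => F s i j).

Lemma mx_continuous_exp (K : realType) (n : nat) (A : 'M[K]_n) :
  mx_continuous (fun s => expmx (s *: A)).
Proof.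
move=> i j; under eq_fun do rewrite expmxE.
exact/exp_bounded_continuous/expmx_coef_bounded.
Qed.

Lemma mx_continuous_cst (K : realType) (p q : nat) (C : 'M[K]_(p, q)) :
  mx_continuous (fun=> C).
Proof. by move=> i j; exact: cst_continuous. Qed.

Lemma continuous_sum (K : realType) (I : Type) (r : seq I) (f : I -> K -> K) :
  (forall i, continuous (f i)) -> continuous (fun s => \sum_(i <- r) f i s).
Proof. by move=> fc; apply: continuous_big => //; exact: add_continuous. Qed.

Lemma continuous_prod (K : realType) (I : Type) (r : seq I) (f : I -> K -> K) :
  (forall i, continuous (f i)) -> continuous (fun s => \prod_(i <- r) f i s).
Proof. by move=> fc; apply: continuous_big => //; exact: mul_continuous. Qed.

Lemma mx_continuousM (K : realType) (p q r : nat)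
    (F : K -> 'M[K]_(p, q)) (G : K -> 'M[K]_(q, r)) :
  mx_continuous F -> mx_continuous G -> mx_continuous (fun s => F s *m G s).
Proof.
move=> Fc Gc i j; under eq_fun do rewrite mxE.
by apply: continuous_sum => k s; apply: continuousM; [exact: Fc|exact: Gc].
Qed.

Lemma mx_continuousD (K : realType) (p q : nat) (F G : K -> 'M[K]_(p, q)) :
  mx_continuous F -> mx_continuous G -> mx_continuous (fun s => F s + G s).
Proof.
move=> Fc Gc i j; under eq_fun do rewrite mxE.
by move=> s; apply: continuousD; [exact: Fc|exact: Gc].
Qed.

Lemma mx_continuousZ (K : realType) (p q : nat) (a : K -> K)
    (F : K -> 'M[K]_(p, q)) :
  continuous a -> mx_continuous F -> mx_continuous (fun s => a s *: F s).
Proof.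
move=> ac Fc i j; under eq_fun do rewrite mxE.
by move=> s; apply: continuousM; [exact: ac|exact: Fc].
Qed.

Lemma continuous_det (K : realType) (p : nat) (F : K -> 'M[K]_p) :
  mx_continuous F -> continuous (fun s => \det (F s)).
Proof.
move=> Fc; apply: (continuous_sum (f := fun (sg : {perm 'I_p}) s =>
  (-1) ^+ sg * \prod_i F s i (sg i))) => sg s.
apply: (@continuousM _ _ (fun=> (-1) ^+ sg) 
  (fun s => \prod_i F s i (sg i))); first exact: cst_continuous.
by apply: continuous_prod => i; exact: Fc.
Qed.

Lemma mx_continuous_inv (K : realType) (p : nat) (F : K -> 'M[K]_p) :
  (forall s, F s \in unitmx) -> mx_continuous F ->
  mx_continuous (fun s => invmx (F s)).
Proof.
move=> Fu Fc; under eq_fun do rewrite /invmx Fu.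
apply: mx_continuousZ.
  move=> s; apply: (@continuousV _ _ (fun s => \det (F s))).
    by have := Fu s; rewrite unitmxE unitfE.
  exact: continuous_det.
move=> i j; under eq_fun do rewrite mxE.
move=> s; apply: (@continuousM _ _ (fun=> (-1) ^+ (j + i))
  (fun s => \det (row' j (col' i (F s))))); first exact: cst_continuous.
apply: continuous_det => k l; under eq_fun do rewrite !mxE.
exact: Fc.
Qed.

(** * Entrywise integrals *)

Lemma integrable_itv (K : realType) (tau : K) (f : K -> K) :
  continuous f -> lebesgue_measure.-integrable `[0, tau] (EFin \o f).
Proof.
move=> fc; apply: continuous_compact_integrable; first exact: segment_compact.
exact: continuous_subspaceT.
Qed.

Lemma Rintegral_sum_itv (K : realType) (tau : K) (I : Type) (r : seq I)
    (f : I -> K -> K) :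
  (forall i, continuous (f i)) ->
  \int[lebesgue_measure]_(s in `[0, tau]) (\sum_(i <- r) f i s) =
  \sum_(i <- r) \int[lebesgue_measure]_(s in `[0, tau]) f i s.
Proof.
move=> fc; elim: r => [|i r IH].
  under eq_Rintegral do rewrite big_nil.
  by rewrite big_nil Rintegral_cst// mul0r.
rewrite big_cons -IH -RintegralD//; last 2 first.
- exact: integrable_itv.
- by apply: integrable_itv; exact: continuous_sum.
by apply: eq_Rintegral => s _; rewrite big_cons.
Qed.

(** The order on entrywise integrals is thus controlled by the order on the
    integrands. *)
Lemma qform_Rintegral (K : realType) (tau : K) (p : nat) (F : K -> 'M[K]_p) x :
  mx_continuous F ->
  qform (\matrix_(i, j) \int[lebesgue_measure]_(s in `[0, tau]) F s i j) x =
  \int[lebesgue_measure]_(s in `[0, tau]) qform (F s) x.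
Proof.
move=> Fc.
have xFc i j : continuous (fun s => x i 0 * F s i j).
  move=> s; apply: (@continuousM _ _ (fun=> x i 0) (fun s => F s i j)).
    exact: cst_continuous.
  exact: Fc.
have cF i j : continuous (fun s => x i 0 * F s i j * x j 0).
  move=> s; apply: (@continuousM _ _ (fun s => x i 0 * F s i j) (fun=> x j 0)).
    exact: xFc.
  exact: cst_continuous.
under [RHS]eq_Rintegral do rewrite qformE.
rewrite Rintegral_sum_itv => [|i]; last exact: continuous_sum.
rewrite qformE; apply: eq_bigr => i _.
rewrite Rintegral_sum_itv//; apply: eq_bigr => j _; rewrite mxE.
rewrite RintegralZr//; last first.
  exact: integrable_itv.
by rewrite RintegralZl//; apply: integrable_itv; exact: Fc.
Qed.

Lemma continuous_qform (K : realType) (p : nat) (F : K -> 'M[K]_p) x :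
  mx_continuous F -> continuous (fun s => qform (F s) x).
Proof.
move=> Fc.
exact: (mx_continuousM (mx_continuousM (mx_continuous_cst (C := x^T)) Fc)
  (mx_continuous_cst (C := x))).
Qed.

(** * The Riccati map: monotonicity and strict subhomogeneity *)

Section Riccati.
Variables (K : realType) (n m : nat) (A : 'M[K]_n) (B : 'M[K]_(n, m)).
Variables (sigma tau : K) (L : 'M[K]_n) (R : 'M[K]_m).
Hypothesis R_pd : pdmx R.
Implicit Types X Y : 'M[K]_n.

Local Notation E s := (expmx (s *: A)).
Local Notation Q := (Qmx A B sigma R).
Local Notation M := (Mmx A B sigma tau R).
Local Notation f := (fmx A B sigma tau L R).

Lemma QmxE X s :
  Q X s = sigma ^+ 2 *: ((E s *m B)^T *m X *m (E s *m B)) + R.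
Proof. by rewrite /Qmx expmx_tr trmx_mul !mulmxA. Qed.

Lemma qform_Qmx X s y :
  qform (Q X s) y = sigma ^+ 2 * qform X (E s *m B *m y) + qform R y.
Proof. by rewrite QmxE qformD qformZ qform_congr. Qed.

Lemma Qmx_pd X s : psdmx X -> pdmx (Q X s).
Proof.
move=> X_psd; rewrite QmxE; apply: pdmx_add => //.
by apply: psdmxZ; [exact: sqr_ge0|exact: psdmx_congr].
Qed.

Lemma Qmx_mono X Y s : loewner X Y -> loewner (Q X s) (Q Y s).
Proof. by move=> XY y; rewrite !qform_Qmx lerD2r ler_wpM2l ?sqr_ge0. Qed.

Lemma Qmx_subhom b X s : 1 <= b -> loewner (Q (b *: X) s) (b *: Q X s).
Proof.
move=> b1 y; rewrite qformZ !qform_Qmx qformZ mulrCA mulrDr lerD2l.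
by rewrite ler_peMl// qform_ge0//; exact: pdmx_psd.
Qed.

Lemma mx_continuous_integrand X : psdmx X ->
  mx_continuous (fun s => E s *m B *m invmx (Q X s) *m B^T *m expmx (s *: A^T)).
Proof.
move=> X_psd.
have Ec := @mx_continuous_exp K n.
have cst := mx_continuous_cst.
apply: mx_continuousM; last exact: Ec.
apply: mx_continuousM; last exact: cst.
apply: mx_continuousM; first by apply: mx_continuousM; [exact: Ec|exact: cst].
apply: mx_continuous_inv => [s|]; first exact/pdmx_unit/Qmx_pd.
apply: mx_continuousD; last exact: cst.
apply: mx_continuousZ; first exact: cst_continuous.
apply: mx_continuousM; last exact: cst.
apply: mx_continuousM; last exact: Ec.
apply: mx_continuousM; last exact: cst.
by apply: mx_continuousM; [exact: cst|exact: Ec].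
Qed.

Lemma Mmx_integrandE X s :
  E s *m B *m invmx (Q X s) *m B^T *m expmx (s *: A^T) =
  ((E s *m B)^T)^T *m invmx (Q X s) *m (E s *m B)^T.
Proof. by rewrite trmxK trmx_mul -expmx_tr !mulmxA. Qed.

Lemma continuous_qform_integrand X x : psdmx X ->
  continuous (fun s => qform (invmx (Q X s)) ((E s *m B)^T *m x)).
Proof.
move=> X_psd; under eq_fun do rewrite -qform_congr -Mmx_integrandE.
exact/continuous_qform/mx_continuous_integrand.
Qed.

Lemma qform_Mmx X x : psdmx X ->
  qform (M X) x = \int[lebesgue_measure]_(s in `[0, tau])
    qform (invmx (Q X s)) ((E s *m B)^T *m x).
Proof.
move=> X_psd; rewrite qform_Rintegral; last exact: mx_continuous_integrand.
by under eq_Rintegral do rewrite Mmx_integrandE qform_congr.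
Qed.

Lemma Mmx_psd X : psdmx X -> psdmx (M X).
Proof.
move=> X_psd; split; last first.
  move=> x; rewrite -/(qform _ x) qform_Mmx//; apply: Rintegral_ge0 => s _.
  exact/qform_ge0/pdmx_psd/pdmx_inv/Qmx_pd.
apply/symmxP/matrixP => i j; rewrite !mxE; apply: eq_Rintegral => s _.
rewrite Mmx_integrandE; have [/symmxP Ks _] := psdmx_congr ((E s *m B)^T)
  (pdmx_psd (pdmx_inv (Qmx_pd s X_psd))).
by rewrite -[in LHS]Ks mxE.
Qed.

Lemma Mmx_antitone X Y :
  psdmx X -> psdmx Y -> loewner X Y -> loewner (M Y) (M X).
Proof.
move=> X_psd Y_psd XY x.
rewrite [leLHS]qform_Mmx; last by [].
rewrite [leRHS]qform_Mmx; last by [].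
apply: le_Rintegral => //; try exact/integrable_itv/continuous_qform_integrand.
by move=> s _; apply: loewner_inv; [exact: Qmx_pd|exact: Qmx_pd|exact: Qmx_mono].
Qed.

Lemma invmx_scale k b (X : 'M[K]_k) :
  b != 0 -> X \in unitmx -> invmx (b *: X) = b^-1 *: invmx X.
Proof.
by move=> b0 Xu; rewrite invmxZ// unitmxZ// unitfE.
Qed.

(** Q is affine in X with a positive constant term, so scaling X by b >= 1
    scales Q by at most b, and its inverse by at least b^-1. *)
Lemma Mmx_superhom b X :
  psdmx X -> 1 <= b -> loewner (b^-1 *: M X) (M (b *: X)).
Proof.
move=> X_psd b1; have b0 : 0 < b := lt_le_trans ltr01 b1.
have bX_psd : psdmx (b *: X) by apply: psdmxZ => //; exact: ltW.
move=> x; rewrite qformZ [leRHS]qform_Mmx; last by [].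
rewrite [X in _ * X]qform_Mmx; last by [].
rewrite -RintegralZl//; last exact/integrable_itv/continuous_qform_integrand.
apply: le_Rintegral => //; last 2 first.
- exact/integrable_itv/continuous_qform_integrand.
- move=> s _; rewrite -qformZ -invmx_scale ?gt_eqF//; last exact/pdmx_unit/Qmx_pd.
  apply: loewner_inv; [exact: Qmx_pd|by apply: pdmxZ => //; exact: Qmx_pd|].
  exact: Qmx_subhom.
apply: integrable_itv => s.
apply: (@continuousM _ _ (fun=> b^-1)
  (fun s => qform (invmx (Q X s)) ((E s *m B)^T *m x))).
  exact: cst_continuous.
exact: continuous_qform_integrand.
Qed.

(** The parallel sum of X and (M X)^-1, written so that it makes sense for
    singular X and M X. *)
Definition gmx X : 'M[K]_n :=
  let S := psd_sqrtmx X in S *m invmx (1%:M + S *m M X *m S) *m S.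

Lemma fmxE X : f X = (E tau)^T *m gmx X *m E tau + tau *: L.
Proof. by rewrite /fmx /gmx expmx_tr !mulmxA. Qed.

Lemma gmx_core_pd X : psdmx X ->
  pdmx (1%:M + psd_sqrtmx X *m M X *m psd_sqrtmx X).
Proof.
move=> /Mmx_psd M_psd; have [/symmxP Ss _] := psd_sqrtmx_psd X.
rewrite addrC -{1}Ss; apply: pdmx_add; last exact: pdmx_scalar.
exact: psdmx_congr.
Qed.

Lemma gmx_psd X : psdmx X -> psdmx (gmx X).
Proof.
move=> X_psd; have [/symmxP Ss _] := psd_sqrtmx_psd X.
rewrite /gmx -{1}Ss; apply: psdmx_congr.
exact/pdmx_psd/pdmx_inv/gmx_core_pd.
Qed.

(** For X = S S with S invertible, [S (I + S M S)^-1 S] is the inverse of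
    [S^-1 (I + S M S) S^-1 = X^-1 + M]: the square root disappears. *)
Lemma gmx_pdE X : pdmx X -> gmx X = invmx (invmx X + M X).
Proof.
move=> X_pd; have X_psd := pdmx_psd X_pd.
rewrite /gmx; set S := psd_sqrtmx X; set J := 1%:M + _.
have Ju : J \in unitmx by apply/pdmx_unit/gmx_core_pd.
have SS : S *m S = X by exact: psd_sqrtmxK.
have Su : S \in unitmx.
  by have := pdmx_unit X_pd; rewrite -SS unitmx_mul => /andP[].
have XE : invmx X + M X = invmx S *m J *m invmx S.
  rewrite /J mulmxDr mulmx1 mulmxDl !mulmxA mulVmx// mul1mx mulmxK//; congr (_ + _).
  apply: (can_inj (mulKmx (pdmx_unit X_pd))).
  by rewrite mulmxV ?pdmx_unit// -SS -mulmxA mulKVmx// mulmxV.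
have gE : (invmx X + M X) *m (S *m invmx J *m S) = 1%:M.
  by rewrite XE !mulmxA mulmxKV// mulmxK// mulVmx.
have [Hu _] := mulmx1_unit gE.
by rewrite -[LHS](mulKmx Hu) gE mulmx1.
Qed.

Lemma gmx_core_inv_pd X : pdmx X -> pdmx (invmx X + M X).
Proof.
move=> X_pd; rewrite addrC; apply: pdmx_add; last exact: pdmx_inv.
exact/Mmx_psd/pdmx_psd.
Qed.

Lemma gmx_mono X Y : pdmx X -> pdmx Y -> loewner X Y -> loewner (gmx X) (gmx Y).
Proof.
move=> X_pd Y_pd XY; rewrite (gmx_pdE X_pd) (gmx_pdE Y_pd).
apply: loewner_inv; [exact: gmx_core_inv_pd|exact: gmx_core_inv_pd|].
move=> x; rewrite [leLHS]qformD [leRHS]qformD; apply: lerD.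
  exact: loewner_inv.
by apply: Mmx_antitone => //; exact: pdmx_psd.
Qed.

Lemma gmx_subhom b X : pdmx X -> 1 <= b -> loewner (gmx (b *: X)) (b *: gmx X).
Proof.
move=> X_pd b1; have b0 : 0 < b := lt_le_trans ltr01 b1.
have bX_pd := pdmxZ b0 X_pd.
have bV0 : 0 < b^-1 by rewrite invr_gt0.
rewrite (gmx_pdE bX_pd) (gmx_pdE X_pd) -[b in b *: invmx _]invrK.
rewrite -invmx_scale ?gt_eqF//; last first.
  exact/pdmx_unit/gmx_core_inv_pd.
apply: loewner_inv; [|exact: gmx_core_inv_pd|].
  by apply: pdmxZ => //; exact: gmx_core_inv_pd.
move=> x; rewrite qformZ [X in _ * X]qformD [leRHS]qformD mulrDr; apply: lerD.
  by rewrite invmx_scale ?gt_eqF ?pdmx_unit// qformZ.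
by rewrite -qformZ; apply: Mmx_superhom => //; exact: pdmx_psd.
Qed.

Lemma qform_fmx X x :
  qform (f X) x = qform (gmx X) (E tau *m x) + tau * qform L x.
Proof. by rewrite fmxE qformD qform_congr qformZ. Qed.

Lemma fmx_mono X Y : pdmx X -> pdmx Y -> loewner X Y -> loewner (f X) (f Y).
Proof.
by move=> X_pd Y_pd XY x; rewrite !qform_fmx lerD2r; exact: gmx_mono.
Qed.

(** The subtracted term is the strict gain: tau L is not multiplied by b. *)
Lemma fmx_subhom b X x : pdmx X -> 1 <= b ->
  qform (f (b *: X)) x <= b * qform (f X) x - (b - 1) * (tau * qform L x).
Proof.
move=> X_pd b1; rewrite !qform_fmx.
have := gmx_subhom X_pd b1 (E tau *m x); rewrite qformZ.
set u := qform _ _; set v := qform _ _; set w := tau * _.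
have -> : b * (v + w) - (b - 1) * w = b * v + w by ring.
by rewrite lerD2r.
Qed.

Hypothesis tau_gt0 : 0 < tau.
Hypothesis L_pd : pdmx L.

Lemma fmx_pd X : psdmx X -> pdmx (f X).
Proof.
move=> X_psd; rewrite fmxE; apply: pdmx_add; last exact: pdmxZ.
exact/psdmx_congr/gmx_psd.
Qed.

(** * Contraction towards a fixed point *)

Section FixedPoint.
Variable W : 'M[K]_n.
Hypotheses (W_psd : psdmx W) (W_fix : f W = W).

Lemma fixed_pd : pdmx W.
Proof. by rewrite -W_fix; exact: fmx_pd. Qed.

(** W <= c tau L for some c > 0, since tau L is positive definite; then
    rho = 1 - (1 + c)^-1 works, the 1 keeping rho nonnegative. *)
Lemma contraction_rate : exists2 rho : K, 0 <= rho < 1 &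
  forall x, (1 - rho) * qform W x <= tau * qform L x.
Proof.
have [c c0 Wc] := loewner_dominated W (pdmxZ tau_gt0 L_pd).
have c1 : 0 < 1 + c by lra.
have cV : 0 < (1 + c)^-1 <= 1 by rewrite invr_gt0 c1 invf_le1//; lra.
exists (1 - (1 + c)^-1); first lra.
move=> x; rewrite opprB subrKC mulrC ler_pdivrMr//.
apply: le_trans (Wc x) _; rewrite !qformZ mulrC ler_wpM2l//; last lra.
by apply: mulr_ge0; [exact: ltW|exact/qform_ge0/pdmx_psd].
Qed.

Variable rho : K.
Hypothesis rho01 : 0 <= rho < 1.
Hypothesis rhoW : forall x, (1 - rho) * qform W x <= tau * qform L x.

(** Monotonicity moves the bound through f, and the gain t tau L absorbs the
    fraction 1 - rho of the excess t W. *)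
Lemma fmx_upper X t : pdmx X -> 0 <= t ->
  loewner X ((1 + t) *: W) -> loewner (f X) ((1 + rho * t) *: W).
Proof.
move=> X_pd t0 XW; have W_pd := fixed_pd.
have tW_pd : pdmx ((1 + t) *: W) by apply: pdmxZ => //; lra.
move=> x; apply: le_trans (fmx_mono X_pd tW_pd XW x) _.
have t1 : 1 <= 1 + t by lra.
apply: le_trans (fmx_subhom x W_pd t1) _; rewrite W_fix qformZ.
have -> : 1 + t - 1 = t by ring.
have := ler_wpM2l t0 (rhoW x); nra.
Qed.

(** Subhomogeneity is applied at (1 - u) W with the factor (1 - u)^-1, which
    brings it back to W and so bounds f ((1 - u) W) from below. *)
Lemma fmx_lower X u : pdmx X -> 0 <= u < 1 ->
  loewner ((1 - u) *: W) X -> loewner ((1 - rho * u) *: W) (f X).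
Proof.
move=> X_pd /andP[u0 u1] WX; have W_pd := fixed_pd.
have a0 : 0 < 1 - u by lra.
have aW_pd : pdmx ((1 - u) *: W) by exact: pdmxZ.
move=> x; apply: le_trans (fmx_mono aW_pd X_pd WX x).
have aV1 : 1 <= (1 - u)^-1 by rewrite invf_ge1//; lra.
have := fmx_subhom x aW_pd aV1.
rewrite scalerA mulVf ?gt_eqF// scale1r W_fix => /(ler_wpM2l (ltW a0)).
rewrite mulrBr !mulrA mulrBr mulfV ?gt_eqF// !mul1r mulr1 qformZ.
have := ler_wpM2l u0 (rhoW x); nra.
Qed.

Lemma iter_fmx_bounds X t u N : pdmx X -> 0 <= t -> 0 <= u < 1 ->
  loewner X ((1 + t) *: W) -> loewner ((1 - u) *: W) X ->
  [/\ pdmx (iter N f X), loewner (iter N f X) ((1 + rho ^+ N * t) *: W) &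
      loewner ((1 - rho ^+ N * u) *: W) (iter N f X)].
Proof.
move=> X_pd t0 /andP[u0 u1] XW WX; have /andP[rho0 rho1] := rho01.
elim: N => [|N [IHpd IHup IHlow]]; first by rewrite expr0 !mul1r.
have rN0 : 0 <= rho ^+ N by exact: exprn_ge0.
have rN1 : rho ^+ N <= 1 by rewrite exprn_ile1// ltW.
rewrite iterS exprS -!mulrA; split.
- exact/fmx_pd/pdmx_psd.
- by apply: fmx_upper => //; exact: mulr_ge0.
- apply: fmx_lower => //; rewrite mulr_ge0//=; nra.
Qed.

End FixedPoint.
End Riccati.

(** * Convergence *)

Lemma polarization (K : realType) (n : nat) (X : 'M[K]_n) (i j : 'I_n) :
  X^T = X ->
  X i j = 2^-1 * (qform X (delta_mx j 0 + delta_mx i 0)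
                  - qform X (delta_mx i 0) - qform X (delta_mx j 0)).
Proof.
move=> Xs; rewrite qform_addv// trmx_delta -rowE.
suff -> : (row i X *m delta_mx j (0 : 'I_1)) ord0 ord0 = X i j by field.
by rewrite -colE !mxE.
Qed.

(** Quadratic forms converge by the squeeze theorem for real sequences, and
    polarization recovers the entries. *)
Lemma loewner_squeeze (K : realType) (n : nat) (a b : nat -> K)
    (X : nat -> 'M[K]_n) (W : 'M[K]_n) :
  W^T = W -> (forall N, (X N)^T = X N) ->
  (forall N, loewner (a N *: W) (X N)) ->
  (forall N, loewner (X N) (b N *: W)) ->
  a @ \oo --> (1 : K) -> b @ \oo --> (1 : K) -> X @ \oo --> W.
Proof.
move=> Ws Xs aX Xb a1 b1.
have qX v : qform (X N) v @[N --> \oo] --> qform W v.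
  apply: (@squeeze_cvgr _ _ _ _ (fun N => a N * qform W v)
    (fun N => b N * qform W v)).
  - by apply: nearW => N; have := aX N v; have := Xb N v; rewrite !qformZ => -> ->.
  - by rewrite -[X in _ --> X]mul1r; apply: cvgMr_tmp.
  - by rewrite -[X in _ --> X]mul1r; apply: cvgMr_tmp.
apply: cvg_mx => i j; under eq_fun do rewrite polarization//.
rewrite polarization//; apply: cvgMl_tmp.
by apply: cvgB; [apply: cvgB|]; exact: qX.
Qed.

Theorem theorem1 (K : realType) (n m : nat)
    (A : 'M[K]_n) (B : 'M[K]_(n, m)) (sigma tau : K)
    (L : 'M[K]_n) (R : 'M[K]_m)
    (tau_gt0 : 0 < tau) (L_pd : pdmx L) (R_pd : pdmx R)
    (W : 'M[K]_n) (W_psd : psdmx W)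
    (W_fix : fmx A B sigma tau L R W = W) :
  (forall V : 'M[K]_n, psdmx V -> fmx A B sigma tau L R V = V -> V = W) /\
  (forall P : 'M[K]_n, psdmx P ->
     (fun N : nat => iter N (fmx A B sigma tau L R) P) @ \oo --> W).
Proof.
set f := fmx A B sigma tau L R.
have cvgW P : psdmx P -> (fun N => iter N f P) @ \oo --> W.
  (* P may be singular, but f P is positive definite, so the orbit is compared
     with multiples of W from the first iterate on. *)
  move=> P_psd; rewrite -cvg_shiftS; under eq_fun do rewrite iterSr.
  have X_pd : pdmx (f P) by exact: fmx_pd.
  have W_pd : pdmx W by apply: fixed_pd W_fix.
  have [rho rho01 rhoW] := contraction_rate tau_gt0 L_pd W.
  have [c c0 Xc] := loewner_dominated (f P) W_pd.
  have [d d0 Wd] := loewner_dominated W X_pd.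
  have d1 : 0 < 1 + d by lra.
  have dV : 0 < (1 + d)^-1 <= 1 by rewrite invr_gt0 d1 invf_le1//; lra.
  pose u := 1 - (1 + d)^-1.
  have u01 : 0 <= u < 1 by rewrite /u; lra.
  have Xup : loewner (f P) ((1 + c) *: W).
    move=> x; apply: le_trans (Xc x) _; rewrite !qformZ ler_wpM2r//; last lra.
    exact: qform_ge0.
  have Xlow : loewner ((1 - u) *: W) (f P).
    move=> x; rewrite qformZ /u opprB subrKC mulrC ler_pdivrMr//.
    apply: le_trans (Wd x) _; rewrite qformZ mulrC ler_wpM2l//; last lra.
    exact/qform_ge0/pdmx_psd.
  have bounds N := iter_fmx_bounds R_pd tau_gt0 L_pd W_psd W_fix rho01 rhoW N
    X_pd (ltW c0) u01 Xup Xlow.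
  have rhoN : rho ^+ N @[N --> \oo] --> (0 : K).
    by apply: cvg_expr; rewrite ger0_norm; lra.
  apply: (loewner_squeeze (a := fun N => 1 - rho ^+ N * u)
    (b := fun N => 1 + rho ^+ N * c)).
  - by case: W_pd => /symmxP.
  - by move=> N; have [[/symmxP]] := bounds N.
  - by move=> N; have [] := bounds N.
  - by move=> N; have [] := bounds N.
  - rewrite -[X in _ --> X](subr0 1) -[X in _ - X](mul0r u).
    by apply: cvgB; [exact: cvg_cst|exact: cvgMr_tmp].
  - rewrite -[X in _ --> X](addr0 1) -[X in _ + X](mul0r c).
    by apply: cvgD; [exact: cvg_cst|exact: cvgMr_tmp].
(* The constant orbit of V converges both to V and to W. *)
split=> // V V_psd V_fix; have := cvgW V V_psd.
have -> : (fun N => iter N f V) = fun=> V.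
  by apply/funext; elim=> //= N ->.
by move=> /(cvg_unique (@norm_hausdorff _ _)) => /(_ V) ->//; exact: cvg_cst.
Qed.
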